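(* Let $X$ be a reflexive real Banach space and let $A\colon X\rightrightarrows X^*$ be a maximally monotone linear relation. Let $A_+=\tfrac12 A+\tfrac12 A^*$ be its symmetric part. Suppose that $\operatorname{dom}A$ and $\operatorname{ran}A_+$ are closed. Then the following are equivalent: (i) $A$ is rectangular. (ii) $\overline{\operatorname{ran}A}=\operatorname{ran}A_+$. (iii) $\ker A_+=\ker A$. (iv) $A$ is paramonotone. (v) $A^*$ is paramonotone. (vi) $A^*$ is rectangular.
   Context: $X$ is a real Banach space with dual $X^*$ and pairing $\langle\cdot,\cdot\rangle$; since $X$ is reflexive, $X^{**}$ is identified with $X$. For a set-valued operator $A\colon X\rightrightarrows X^*$: $\operatorname{gra}A=\{(x,x^* )\in X\times X^*\mid x^*\in Ax\}$, $\operatorname{dom}A=\{x\mid Ax\neq\varnothing\}$, $\operatorname{ran}A=\bigcup_{x\in X}Ax$, $\ker A=\{x\mid 0\in Ax\}$. Sums and scalar multiples of operators are pointwise: $(\alpha A+\beta B)x=\alpha Ax+\beta Bx$ (Minkowski sum, empty if $Ax$ or $Bx$ is empty). $A$ is a linear relation if $\operatorname{gra}A$ is a linear subspace of $X\times X^*$. Its adjoint $A^*\colon X^{**}\rightrightarrows X^*$ has graph $\operatorname{gra}A^*=\{(x^{**},x^* )\in X^{**}\times X^*\mid \langle x^*,a\rangle=\langle a^*,x^{**}\rangle\ \text{for all }(a,a^* )\in\operatorname{gra}A\}$; for reflexive $X$ it is regarded as an operator $X\rightrightarrows X^*$. $A$ is monotone if $\langle x-y,x^*-y^*\rangle\ge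 0$ for all $(x,x^* ),(y,y^* )\in\operatorname{gra}A$, and maximally monotone if moreover no monotone operator has a graph properly containing $\operatorname{gra}A$. For a monotone $A$ with nonempty graph, the Fitzpatrick function is $F_A\colon X\times X^*\to\,]-\infty,+\infty]$, $F_A(x,x^* )=\sup_{(a,a^* )\in\operatorname{gra}A}(\langle x,a^*\rangle+\langle a,x^*\rangle-\langle a,a^*\rangle)$, with $\operatorname{dom}F_A=\{(x,x^* )\mid F_A(x,x^* )<+\infty\}$. Such an $A$ is rectangular if $\operatorname{dom}A\times\operatorname{ran}A\subseteq\operatorname{dom}F_A$; it is paramonotone if whenever $(x,x^* ),(y,y^* )\in\operatorname{gra}A$ satisfy $\langle x-y,x^*-y^*\rangle=0$, then $(x,y^* )\in\operatorname{gra}A$ and $(y,x^* )\in\operatorname{gra}A$. *)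

(* Defs.v *)
From HB Require Import structures.
From mathcomp Require Import all_boot all_order all_algebra.
From mathcomp Require Import boolp classical_sets functions reals ereal.
From mathcomp Require Import topology normedtype.

Set Implicit Arguments.
Unset Strict Implicit.
Unset Printing Implicit Defensive.

Import Order.TTheory GRing.Theory Num.Theory.
Import numFieldNormedType.Exports.

Local Open Scope classical_set_scope.
Local Open Scope ring_scope.

Section dual_space.
Context {R : realType} (X : normedModType R).

Definition continuous_linear : {pred X -> R^o} :=
  mem [set f : X -> R^o | linear f /\ continuous f].

Record dual := Dual {
  dual_fun :> X -> R^o ;
  dual_funP : dual_fun \in continuous_linear }.

HB.instance Definition _ := [isSub for dual_fun].
HB.instance Definition _ := [Choice of dual by <:].

Lemma continuous_linearP (f : X -> R^o) :
  reflect (linear f /\ continuous f) (f \in continuous_linear).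
Proof. exact: asboolP. Qed.

Lemma continuous_linear_submod : submod_closed continuous_linear.
Proof.
split.
  apply/continuous_linearP; split; last exact: cst_continuous.
  by move=> a u v; rewrite scaler0 addr0.
move=> k f g /continuous_linearP[lf cf] /continuous_linearP[lg cg].
apply/continuous_linearP; split.
  move=> a u v; rewrite /= !fctE lf lg !scalerDr !scalerA (mulrC k a).
  by rewrite addrACA.
by move=> x; apply: cvgD; [apply: cvgZr; exact: cf | exact: cg].
Qed.

HB.instance Definition _ :=
  GRing.isSubmodClosed.Build R (X -> R^o) continuous_linear
    continuous_linear_submod.
HB.instance Definition _ := [SubChoice_isSubLmodule of dual by <:].

Lemma dual_linear (f : dual) : linear f.
Proof. by case/continuous_linearP: (dual_funP f). Qed.

Lemma dual_continuous (f : dual) : continuous f.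
Proof. by case/continuous_linearP: (dual_funP f). Qed.

HB.instance Definition _ (f : dual) :=
  GRing.isLinear.Build R X R^o *:%R (dual_fun f) (dual_linear f).

Lemma dualDE (f g : dual) x : (f + g) x = f x + g x.
Proof. by []. Qed.

Lemma dualZE (k : R) (f : dual) x : (k *: f) x = k * f x.
Proof. by []. Qed.

Lemma dualP (f g : dual) : (forall x, f x = g x) -> f = g.
Proof. by move=> fg; apply: val_inj; apply: funext. Qed.

Definition dual_norm (f : dual) : R :=
  sup [set `|f x| | x in [set x : X | `|x| <= 1]].

Lemma dual_norm_has_sup (f : dual) :
  has_sup [set `|f x| | x in [set x : X | `|x| <= 1]].
Proof.
split; first by exists `|f 0|; exists 0 => //=; rewrite normr0.
have /linear_bounded_continuous/bounded_funP/(_ 1)[M fM] :=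
  @dual_continuous f.
by exists M => _ [x x1 <-]; exact: fM.
Qed.

Lemma dual_norm_le1 (f : dual) x : `|x| <= 1 -> `|f x| <= dual_norm f.
Proof.
move=> x1; apply: sup_upper_bound; first exact: dual_norm_has_sup.
by exists x.
Qed.

Lemma dual_norm_lub (f : dual) M :
  (forall x, `|x| <= 1 -> `|f x| <= M) -> dual_norm f <= M.
Proof.
move=> fM; apply: ge_sup; first by case: (dual_norm_has_sup f).
by move=> _ [x x1 <-]; exact: fM.
Qed.

Lemma dual_norm_ge0 (f : dual) : 0 <= dual_norm f.
Proof. by apply: (le_trans (normr_ge0 (f 0))); rewrite dual_norm_le1 ?normr0. Qed.

Lemma dual_normP (f : dual) x : `|f x| <= dual_norm f * `|x|.
Proof.
have [->|x0] := eqVneq x 0; first by rewrite linear0 !normr0 mulr0.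
have nx0 : 0 < `|x| by rewrite normr_gt0.
have : `|f (`|x|^-1 *: x)| <= dual_norm f.
  by rewrite dual_norm_le1// normrZ normfV normr_id mulVf// gt_eqF.
rewrite linearZ /= normrZ normfV normr_id mulrC.
by rewrite ler_pdivrMr.
Qed.

Lemma dual_normD (f g : dual) :
  dual_norm (f + g) <= dual_norm f + dual_norm g.
Proof.
apply: dual_norm_lub => x x1; apply: (le_trans (ler_normD _ _)).
by apply: lerD; exact: dual_norm_le1.
Qed.

Lemma dual_normZ (k : R) (f : dual) : dual_norm (k *: f) = `|k| * dual_norm f.
Proof.
apply/eqP; rewrite eq_le; apply/andP; split.
  apply: dual_norm_lub => x x1; rewrite dualZE normrM.
  by apply: ler_wpM2l => //; exact: dual_norm_le1.
have [->|k0] := eqVneq k 0; first by rewrite normr0 mul0r dual_norm_ge0.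
rewrite mulrC -ler_pdivlMr ?normr_gt0//; apply: dual_norm_lub => x x1.
by rewrite ler_pdivlMr ?normr_gt0// mulrC -normrM -dualZE dual_norm_le1.
Qed.

Lemma dual_norm0_eq0 (f : dual) : dual_norm f = 0 -> f = 0.
Proof.
move=> f0; apply: dualP => x; apply/eqP.
by rewrite -normr_le0 (le_trans (dual_normP f x))// f0 mul0r.
Qed.

HB.instance Definition _ :=
  Lmodule_isNormed.Build R dual dual_normD dual_normZ dual_norm0_eq0.

End dual_space.

Arguments continuous_linear {R} X _.
Arguments dual {R} X.

Section bidual.
Context {R : realType} {X : normedModType R}.

Definition evaluation (x : X) : dual X -> R^o := fun f => f x.

Lemma evaluation_continuous_linear x :
  evaluation x \in continuous_linear (dual X).
Proof.
apply/continuous_linearP; have lin : linear (evaluation x) by [].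
pose e : {linear dual X -> R^o} :=
  HB.pack (evaluation x) (GRing.isLinear.Build _ _ _ _ _ lin).
split=> //; apply: (@bounded_linear_continuous _ _ _ e); apply/bounded_funP => r.
exists (r * `|x|) => f fr; apply: (le_trans (dual_normP f x)).
by apply: ler_wpM2r.
Qed.

Definition canonical_embedding (x : X) : dual (dual X) :=
  Dual (evaluation_continuous_linear x).

End bidual.

Definition reflexive_space (R : realType) (X : normedModType R) :=
  range (@canonical_embedding R X) = [set: dual (dual X)].

Section set_valued_operators.
Context {U V : Type}.
Implicit Type A : U -> set V.

Definition gra A : set (U * V) := [set p | A p.1 p.2].
Definition dom A : set U := [set x | A x !=set0].
Definition ran A : set V := \bigcup_x A x.

End set_valued_operators.

Section set_valued_algebra.
Context {R : realType} {U V : lmodType R}.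
Implicit Type A B : U -> set V.

Definition ker A : set U := [set x | A x 0].

Definition op_scale (k : R) A : U -> set V := fun x => [set k *: a | a in A x].

Definition op_add A B : U -> set V :=
  fun x => [set a + b | a in A x & b in B x].

Definition linear_relation A := submod_closed (mem (gra A)).

End set_valued_algebra.

Section monotone_operators.
Context {R : realType} {X : normedModType R}.
Implicit Type A : X -> set (dual X).

Definition bidual_adjoint A : dual (dual X) -> set (dual X) :=
  fun x2 => [set xstar |
    forall a astar, gra A (a, astar) -> xstar a = x2 astar].

(* For reflexive X, the adjoint as an operator from X to its dual, X being
   identified with its bidual by the canonical embedding. *)
Definition adjoint A : X -> set (dual X) :=
  fun x => bidual_adjoint A (canonical_embedding x).

Definition symmetric_part A : X -> set (dual X) :=
  op_add (op_scale 2^-1 A) (op_scale 2^-1 (adjoint A)).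

Definition monotone A := forall x xstar y ystar,
  gra A (x, xstar) -> gra A (y, ystar) -> 0 <= (xstar - ystar) (x - y).

Definition maximally_monotone A := monotone A /\
  ~ exists B : X -> set (dual X), monotone B /\ gra A `<` gra B.

Definition fitzpatrick A (p : X * dual X) : \bar R :=
  ereal_sup [set (a.2 p.1 + p.2 a.1 - a.2 a.1)%:E | a in gra A].

Definition dom_fitzpatrick A : set (X * dual X) :=
  [set p | (fitzpatrick A p < +oo)%E].

(* Rectangularity and paramonotonicity are notions about monotone operators,
   with nonempty graph, so both include these conditions. *)
Definition rectangular A :=
  [/\ monotone A, gra A !=set0 & dom A `*` ran A `<=` dom_fitzpatrick A].

Definition paramonotone A :=
  [/\ monotone A, gra A !=set0 &
    forall x xstar y ystar, gra A (x, xstar) -> gra A (y, ystar) ->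
      (xstar - ystar) (x - y) = 0 -> gra A (x, ystar) /\ gra A (y, xstar)].

End monotone_operators.

(* Main.v *)
From HB Require Import structures.
Require Import Defs.
From mathcomp Require Import all_boot all_order all_algebra.
From mathcomp Require Import boolp classical_sets functions reals ereal.
From mathcomp Require Import topology normedtype sequences.
From mathcomp Require Import ring lra.

(* Let D = dom A.  Maximality gives A 0 = D^perp, so A amounts to a bilinear
   form b on D, nonnegative on the diagonal, with f in A x iff f = b(x, .) on D.
   Since D is complete, uniform boundedness applied to the functionals
   f / (1 + <a, f>) with (a, f) in gra A and |a| <= 1 makes b bounded, hence, by
   Hahn-Banach, A^* and A_+ have domain D too and are given in the same way by
   the transpose of b and by its symmetric part s.

   Say that b is nondegenerate if b(x, x) = 0 implies b(x, .) = 0; since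
   b(x, x) = 0 forces s(x, .) = 0, this is invariant under transposition.
   Rectangularity means that b(a, x) + b(y, a) - b(a, a) is bounded above in a,
   which is also invariant under transposition.  All six conditions are
   equivalent to nondegeneracy.  The closed range of A_+ enters as follows: if b
   is nondegenerate, every b(w, .) vanishes on the kernel of s, so by Hahn-Banach
   and reflexivity b(w, .) = s(v, .) for some v, and rectangularity follows by
   completing the square. *)

Import Order.TTheory GRing.Theory Num.Theory.
Import numFieldNormedType.Exports.
Local Open Scope classical_set_scope.
Local Open Scope ring_scope.

(** * Linear subspaces and linear relations as sets *)

Section submod_sets.
Context {R : realType} {X : lmodType R} (D : set X).
Hypothesis D_submod : submod_closed (mem D).

Lemma mem_submod0 : D 0. Proof. by case: D_submod => /set_mem. Qed.

Lemma mem_submodP k x y : D x -> D y -> D (k *: x + y).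
Proof.
case: D_submod => _ linD Dx Dy.
exact/set_mem/(linD k x y (mem_set Dx) (mem_set Dy)).
Qed.

Lemma mem_submodZ k x : D x -> D (k *: x).
Proof.
by move=> Dx; have := mem_submodP k _ _ Dx mem_submod0; rewrite addr0.
Qed.

Lemma mem_submodD x y : D x -> D y -> D (x + y).
Proof. by move=> Dx; rewrite -[x]scale1r; exact: mem_submodP. Qed.

Lemma mem_submodB x y : D x -> D y -> D (x - y).
Proof.
move=> Dx Dy; apply: mem_submodD => //.
by rewrite -scaleN1r; exact: mem_submodZ.
Qed.

End submod_sets.

Section linear_relations.
Context {R : realType} {U V : lmodType R}.
Implicit Type G : U -> set V.

Lemma linear_relationP G :
  linear_relation G <->
  G 0 0 /\ forall k u v x y, G u x -> G v y -> G (k *: u + v) (k *: x + y).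
Proof.
split=> -[G0 Glin]; split.
- by move/set_mem: G0.
- move=> k u v x y Gx Gy.
  by have /set_mem := Glin k (u, x) (v, y) (mem_set Gx) (mem_set Gy).
- exact/mem_set.
- move=> k [u x] [v y] /set_mem Gx /set_mem Gy.
  by apply/mem_set; exact: (Glin k u v x y Gx Gy).
Qed.

End linear_relations.

(** * Hahn-Banach *)

Section hahn_banach.
Context {R : realType} {V : normedModType R} {C : R}.
Implicit Type G : V -> set R^o.

(** Partial functionals are encoded as graphs, which Zorn's lemma can unite. Single-valuedness
    follows from the bound, since both [r] and [- r] are at most 0 when [G 0 r]. *)
Definition dominated G := linear_relation G /\
  forall v r, G v r -> r <= C * `|v|.

Definition extend G (v0 : V) (r0 : R) : V -> set R^o := fun v => [set r |
  exists u s t, [/\ G u s, v = u + t *: v0 & r = s + t * r0]].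

(** Dividing by [|t|] reduces the bound at [u + t *: v0] to the cases t = 1 and t = -1, which are
    the two assumed inequalities. *)
Lemma extend_dominated G v0 r0 : dominated G ->
  (forall u s, G u s -> s - C * `|u - v0| <= r0 <= C * `|u + v0| - s) ->
  dominated (extend G v0 r0).
Proof.
move=> [/linear_relationP[G0 Glin] GC] r0P; split.
  apply/linear_relationP; split.
    by exists 0, 0, 0; rewrite scale0r mul0r !addr0.
  move=> k _ _ _ _ [u [s [t [Gus -> ->]]]] [u' [s' [t' [Gus' -> ->]]]].
  exists (k *: u + u'), (k *: s + s'), (k * t + t'); split.
  - exact: Glin.
  - by rewrite scalerDr scalerA scalerDl addrACA.
  - by rewrite scalerDr mulrDl addrACA -mulrA.
move=> _ _ [u [s [t [Gus -> ->]]]].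
have GZ k : G (k *: u) (k * s).
  by have := Glin k _ _ _ _ Gus G0; rewrite !addr0.
case: (ltgtP t 0) => [t0|t0|->]; last by rewrite scale0r mul0r !addr0 GC.
- have nt0 : 0 < - t by rewrite oppr_gt0.
  have /andP[+ _] := r0P _ _ (GZ (- t)^-1).
  have -> : u + t *: v0 = (- t) *: ((- t)^-1 *: u - v0).
    by rewrite scalerBr scalerA divff ?gt_eqF// scale1r scaleNr opprK.
  rewrite normrZ gtr0_norm// lerBlDr -(ler_pM2l nt0) mulrDr mulrA.
  by rewrite divff ?gt_eqF// mul1r; lra.
- have /andP[_] := r0P _ _ (GZ t^-1).
  have -> : u + t *: v0 = t *: (t^-1 *: u + v0).
    by rewrite scalerDr scalerA divff ?gt_eqF// scale1r.
  rewrite normrZ gtr0_norm// lerBrDr -(ler_pM2l t0) mulrDr mulrA.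
  by rewrite divff ?gt_eqF// mul1r; lra.
Qed.

Lemma dominated_ext G v0 : 0 <= C -> dominated G ->
  exists r0, dominated (extend G v0 r0).
Proof.
move=> C0 domG; have [/linear_relationP[G0 Glin] GC] := domG.
(* Each lower bound for [r0] is below each upper bound, because s + r <= C |u + w| <= C |u - v0| + C
   |w + v0|. The supremum of the lower bounds is therefore admissible. *)
pose E := [set r : R | exists u s, G u s /\ r = s - C * `|u - v0|].
have E0 : E !=set0 by exists (0 - C * `|0 - v0|), 0, 0.
have EP w r : G w r -> ubound E (C * `|w + v0| - r).
  move=> Gw _ [u [s [Gu ->]]].
  rewrite lerBrDr addrAC lerBlDr.
  have := Glin 1 _ _ _ _ Gu Gw; rewrite !scale1r => /GC /le_trans; apply.
  rewrite -mulrDr ler_wpM2l// addrC.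
  by rewrite (le_trans _ (ler_normD _ _))// addrC addrACA subrr addr0 addrC.
exists (sup E); apply: extend_dominated => // u s Gu; apply/andP; split.
  apply: sup_upper_bound; last by exists u, s.
  by split=> //; exists (C * `|u + v0| - s); exact: EP.
by apply: ge_sup => //; exact: EP.
Qed.

Theorem hahn_banach_dominated G : 0 <= C -> dominated G ->
  exists f : dual V, forall v r, G v r -> f v = r.
Proof.
move=> C0 domG.
(* The premise [S !=set0] lets the union of the empty chain satisfy [P]. *)
pose P (S : set (V * R^o)) :=
  S !=set0 -> gra G `<=` S /\ dominated (fun v => [set r | S (v, r)]).
have [F FP Ftot|S [PS Smax]] := @Zorn_bigcup _ P.
  move=> [p [S0 FS0 S0p]]; split.
    move=> q Gq; exists S0 => //.
    by have [|+ _] := FP _ FS0; [by exists p | exact].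
  split; last first.
    move=> v r [S FS Svr]; have [|_ [_ +]] := FP _ FS; first by exists (v, r).
    exact.
  apply/linear_relationP; split.
    exists S0 => //; have [|_ [/linear_relationP[+ _] _]] := FP _ FS0.
      by exists p.
    exact.
  move=> k u v x y [S1 FS1 S1u] [S2 FS2 S2v].
  have [S12|S21] := Ftot _ _ FS1 FS2.
    exists S2 => //; have [|_ [/linear_relationP[_ +] _]] := FP _ FS2.
      by exists (v, y).
    by apply => //=; exact: S12.
  exists S1 => //; have [|_ [/linear_relationP[_ +] _]] := FP _ FS1.
    by exists (u, x).
  by apply => //=; exact: S21.
have S0 : S !=set0.
  apply: contrapT => /set0P/negP; rewrite negbK => /eqP S0.
  apply: (Smax (gra G)); last by split.
  rewrite S0; split; first exact: sub0set.
  have [/linear_relationP[G00 _] _] := domG.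
  by move=> /(_ (0, 0) G00).
have [GS domS] := PS S0.
have [/linear_relationP[S00 Slin] SC] := domS.
have tot v0 : exists r, S (v0, r).
  have [r0 extS] := dominated_ext _ v0 C0 domS.
  pose S' := gra (extend (fun v => [set r | S (v, r)]) v0 r0).
  have SS' : S `<=` S'.
    move=> [v r] Svr; exists v, r, 0; split=> //.
      by rewrite scale0r addr0.
    by rewrite mul0r addr0.
  exists r0; apply: contrapT => nS; apply: (Smax S').
    split=> // S'S; apply: nS; apply: S'S; exists 0, 0, 1; split=> //.
      by rewrite scale1r add0r.
    by rewrite mul1r add0r.
  by split=> //; exact: subset_trans SS'.
have /choice[f fP] := tot.
have SZ k v r : S (v, r) -> S (k *: v, k * r).
  by move=> Sv; have := Slin k _ _ _ _ Sv S00; rewrite !addr0.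
have SN v r : S (v, r) -> `|r| <= C * `|v|.
  move=> Sv; rewrite ler_norml; apply/andP; split; last exact: SC.
  have := SZ (-1) _ _ Sv; rewrite scaleN1r mulN1r => /SC.
  by rewrite normrN lerNl.
have Sfun v r s : S (v, r) -> S (v, s) -> r = s.
  move=> Sr /(Slin (-1) _ _ _ _ Sr); rewrite scaleN1r addNr => /SN.
  by rewrite normr0 mulr0 normr_le0 scaleN1r addrC subr_eq0 => /eqP.
have lf : linear (f : V -> R^o).
  move=> k u v; apply: (Sfun (k *: u + v)); first exact: fP.
  exact: Slin.
pose fl : {linear V -> R^o} := HB.pack f (GRing.isLinear.Build _ _ _ _ _ lf).
have cf : (f : V -> R^o) \in continuous_linear V.
  apply/continuous_linearP; split=> //.
  apply: (@bounded_linear_continuous _ _ _ fl); apply/bounded_funP => r.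
  exists (C * r) => v vr; apply: le_trans (SN _ _ (fP v)) _.
  exact: ler_wpM2l.
by exists (Dual cf) => v r Gvr; apply: (Sfun v); [exact: fP|exact: GS].
Qed.

End hahn_banach.

(** Since [v0] has distance at least some e > 0 from [M], the functional m + r v0 -> r is dominated
    with constant 1/e and extends. *)
Lemma hahn_banach_separation {R : realType} {V : normedModType R}
    (M : set V) (v0 : V) : submod_closed (mem M) -> ~ closure M v0 ->
  exists2 f : dual V, (forall m, M m -> f m = 0) & f v0 != 0.
Proof.
move=> sM Mv0; have M0 := mem_submod0 _ sM; have Mlin := mem_submodP _ sM.
have [e e0 eM] : exists2 e : R, 0 < e & forall m, M m -> e <= `|v0 + m|.
  have /existsNP[B /not_implyP[/nbhs_ballP[e /= e0 eB] MB]] := Mv0.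
  exists e => // m Mm; rewrite leNgt; apply/negP => ve; apply: MB.
  exists (- m); split.
    by have := Mlin (-1) _ _ Mm M0; rewrite scaleN1r addr0.
  by apply: eB; rewrite -ball_normE /= opprK.
pose G (v : V) : set R^o := [set r | exists2 m, M m & v = m + r *: v0].
have domG : dominated (C := e^-1) G.
  split.
    apply/linear_relationP; split.
      by exists 0 => //; rewrite scale0r addr0.
    move=> k _ _ x y [m Mm ->] [n Mn ->]; exists (k *: m + n).
      exact: Mlin.
    by rewrite scalerDr scalerA scalerDl addrACA.
  move=> _ r [m Mm ->]; rewrite mulrC ler_pdivlMr//.
  have [->|r0] := eqVneq r 0; first by rewrite mul0r.
  have -> : m + r *: v0 = r *: (v0 + r^-1 *: m).
    by rewrite scalerDr scalerA divff// scale1r addrC.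
  rewrite normrZ (le_trans (ler_wpM2r (ltW e0) (ler_norm r)))//.
  rewrite ler_wpM2l// eM//.
  by have := Mlin r^-1 _ _ Mm M0; rewrite addr0.
have [|f fG] := hahn_banach_dominated _ _ domG; first by rewrite invr_ge0 ltW.
exists f => [m Mm|].
  by apply: fG; exists m => //; rewrite scale0r addr0.
rewrite (fG v0 1) ?oner_eq0//; exists 0 => //.
by rewrite scale1r add0r.
Qed.

(** * Uniform boundedness on a closed subspace *)

Section closed_subspace.
Context {R : realType} (X : completeNormedModType R).

(** Bundling makes the subspace a complete normed space in its own right, the setting of the
    Banach-Steinhaus theorem. *)
Record closed_subspace := ClosedSubspace {
  carrier : {pred X} ;
  carrier_submod : submod_closed carrier ;
  carrier_closed : closed [set` carrier] }.

Variable D : closed_subspace.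

HB.instance Definition _ :=
  GRing.isSubmodClosed.Build R X (carrier D) (carrier_submod D).

Record subspace_of := SubspaceOf {
  subspace_val :> X ; subspace_valP : subspace_val \in carrier D }.

HB.instance Definition _ := [isSub for subspace_val].
HB.instance Definition _ := [Choice of subspace_of by <:].
HB.instance Definition _ := [SubChoice_isSubLmodule of subspace_of by <:].

Definition subspace_norm (u : subspace_of) : R := `|subspace_val u|.

Lemma subspace_normD u v :
  subspace_norm (u + v) <= subspace_norm u + subspace_norm v.
Proof. exact: ler_normD. Qed.

Lemma subspace_normZ (k : R) u :
  subspace_norm (k *: u) = `|k| * subspace_norm u.
Proof. exact: normrZ. Qed.

Lemma subspace_norm0_eq0 u : subspace_norm u = 0 -> u = 0.
Proof. by move=> /normr0_eq0 u0; apply: val_inj. Qed.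

HB.instance Definition _ := Lmodule_isNormed.Build R subspace_of
  subspace_normD subspace_normZ subspace_norm0_eq0.

Lemma subspace_complete (F : set_system subspace_of) :
  ProperFilter F -> cauchy F -> cvg F.
Proof.
move=> FF /cauchyP Fc.
have Gc : cauchy (subspace_val @ F).
  apply/cauchyP => e e0; have [u Fu] := Fc e e0.
  exists (subspace_val u); rewrite /nbhs /=.
  by apply: filterS Fu => v; rewrite -!ball_normE.
have /cvg_ex[x Gx] : cvg (subspace_val @ F) by exact: cauchy_cvg.
have Dx : x \in carrier D.
  apply: (closed_cvg [set` carrier D] _ _ _ Gx); first exact: carrier_closed.
  by apply: nearW => u; exact: subspace_valP.
apply/cvg_ex; exists (SubspaceOf _ Dx).
apply/cvgrPdist_lt => e e0.
by move/cvgrPdist_lt: Gx => /(_ e e0).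
Qed.

HB.instance Definition _ := Uniform_isComplete.Build subspace_of
  subspace_complete.

End closed_subspace.


(** Banach-Steinhaus for the restrictions to [D]. The bound is raised to at least 1 so that it can
    later be inverted and used as a radius inside the unit ball. *)
Lemma dual_bounded_on_closed {R : realType} {X : completeNormedModType R}
    (D : set X) (F : set (dual X)) :
  submod_closed (mem D) -> closed D ->
  (forall x, D x -> exists M : R, forall f, F f -> `|f x| <= M) ->
  exists2 M, 1 <= M & forall f x, F f -> D x -> `|x| <= 1 -> `|f x| <= M.
Proof.
move=> sD cD FD.
have cD' : closed [set` mem D].
  rewrite (_ : [set` mem D] = D)//.
  by apply/seteqP; split=> x; [exact: set_mem | exact: mem_set].
pose S := subspace_of _ (ClosedSubspace _ _ sD cD').
pose F' : set (S -> R^o) :=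
  [set g | exists2 f, F f & g = f \o @subspace_val _ _ _].
have [] := @Banach_Steinhauss _ S R^o F' _ _ 1.
- move=> _ [f Ff ->]; split=> [r|k u v]; last by rewrite /= linearP.
  exists (dual_norm f * r) => u ur; apply: le_trans (dual_normP f _) _.
  by rewrite ler_wpM2l// dual_norm_ge0.
- move=> u; have [M FM] := FD _ (set_mem (subspace_valP _ _ u)).
  by exists M => _ [f Ff ->]; exact: FM.
move=> M FM; exists (Num.max 1 M); first by rewrite le_max lexx.
move=> f x Ff Dx x1; rewrite le_max; apply/orP; right.
have Sx : x \in carrier _ (ClosedSubspace _ _ sD cD') by exact: mem_set.
have F'f : F' (f \o @subspace_val _ _ _) by exists f.
exact: (FM _ F'f (SubspaceOf _ _ _ Sx)).
Qed.

(** * Operators represented by bilinear forms *)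

Lemma affine_ge0_slope {R : realFieldType} (u v : R) :
  (forall t, 0 <= t * u + v) -> u = 0.
Proof.
move=> uv; apply/eqP/negP => /negP u0.
(* At this point the affine function would equal -1. *)
have := uv (- (v + 1) / u); rewrite divfK// opprD addrAC addNr add0r.
by rewrite oppr_ge0 ler10.
Qed.

(* Only the restrictions of b x to D matter: b stands for a bilinear form on D
   whose sections b(x, .) extend continuously to X. *)
Definition form_op {R : realType} {X : normedModType R} (D : set X)
    (b : X -> dual X) : X -> set (dual X) :=
  fun x => [set f | D x /\ forall y, D y -> f y = b x y].

Section form_op.
Context {R : realType} {X : normedModType R} (D : set X).
Hypothesis D_submod : submod_closed (mem D).

(* Having an adjoint makes b linear in its first argument on D. *)
Definition adjoint_forms (b c : X -> dual X) :=
  forall x y, D x -> D y -> c x y = b y x.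

Lemma adjoint_forms_sym b c : adjoint_forms b c -> adjoint_forms c b.
Proof. by move=> bc x y Dx Dy; rewrite bc. Qed.

Lemma form_opE b x : D x -> form_op D b x (b x).
Proof. by move=> Dx; split. Qed.

Lemma dom_form_op b : dom (form_op D b) = D.
Proof.
apply/seteqP; split=> x; first by case=> f [].
by move=> Dx; exists (b x); exact: form_opE.
Qed.

Lemma ker_form_op b :
  ker (form_op D b) = [set x | D x /\ forall y, D y -> b x y = 0].
Proof.
by apply/seteqP; split=> x [Dx bx]; split=> // y Dy; exact/esym/bx.
Qed.

Lemma ran_form_op b f :
  ran (form_op D b) f <-> exists2 x, D x & forall y, D y -> f y = b x y.
Proof. by split; [case=> x _ [Dx fx]|case=> x Dx fx]; exists x. Qed.

Section additive.
Context (b c : X -> dual X) (bc : adjoint_forms b c).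

Lemma form_linl k x y z : D x -> D y -> D z ->
  b (k *: x + y) z = k * b x z + b y z.
Proof.
move=> Dx Dy Dz; rewrite -[LHS]bc//; last exact: mem_submodP.
by rewrite linearP/= !bc.
Qed.

Lemma form_scalel k x z : D x -> D z -> b (k *: x) z = k * b x z.
Proof.
by move=> Dx Dz; rewrite -[LHS]bc//; [rewrite linearZ/= bc|exact: mem_submodZ].
Qed.

Lemma form_0l z : D z -> b 0 z = 0.
Proof. by move=> Dz; rewrite -[LHS]bc ?linear0//; exact: mem_submod0. Qed.

Lemma form_subl x y z : D x -> D y -> D z -> b (x - y) z = b x z - b y z.
Proof.
move=> Dx Dy Dz; rewrite -[LHS]bc//; last exact: mem_submodB.
by rewrite linearB/= !bc.
Qed.

Lemma linear_form_op : linear_relation (form_op D b).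
Proof.
apply/linear_relationP; split.
  by split=> [|y Dy]; [exact: mem_submod0|rewrite form_0l].
move=> k u v f g [Du fu] [Dv gv]; split=> [|y Dy]; first exact: mem_submodP.
by rewrite form_linl// dualDE dualZE fu// gv.
Qed.

Lemma submod_ran_form_op : submod_closed (mem (ran (form_op D b))).
Proof.
have /linear_relationP[G0 Glin] := linear_form_op; split.
  by apply/mem_set; exists 0.
move=> k f g /set_mem[x _ fx] /set_mem[y _ gy]; apply/mem_set.
by exists (k *: x + y) => //; exact: Glin.
Qed.

Hypothesis b_ge0 : forall x, D x -> 0 <= b x x.

Lemma form_op_diff x y f g : form_op D b x f -> form_op D b y g ->
  (f - g) (x - y) = b (x - y) (x - y).
Proof.
move=> [Dx fx] [Dy gy]; have Dxy := mem_submodB _ D_submod _ _ Dx Dy.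
by rewrite form_subl// -fx// -gy.
Qed.

Lemma monotone_form_op : monotone (form_op D b).
Proof.
move=> x f y g fx gy; rewrite (form_op_diff _ _ _ _ fx gy) b_ge0//.
by apply: (mem_submodB _ D_submod); [case: fx|case: gy].
Qed.

Lemma gra_form_op0 : gra (form_op D b) !=set0.
Proof. by exists (0, b 0); split=> //; exact: mem_submod0. Qed.

Definition nondegenerate_form (b : X -> dual X) :=
  forall x, D x -> b x x = 0 -> forall y, D y -> b x y = 0.

(** Comparing [(x, b x)] with [(0, b 0)] gives nondegeneracy. Conversely, a zero pairing is b(x - y,
    x - y) = 0, whence b(x, .) = b(y, .) on [D] and the values can be exchanged. *)
Lemma paramonotone_form_op :
  paramonotone (form_op D b) <-> nondegenerate_form b.
Proof.
split=> [[_ _ para] x Dx bxx y Dy|nd].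
  have Gx : gra (form_op D b) (x, b x) by split.
  have G0 : gra (form_op D b) (0, b 0) by split=> //; exact: mem_submod0.
  have [|[_ /(_ y Dy)/= <-] _] := para _ _ _ _ Gx G0.
    by rewrite (form_op_diff _ _ _ _ Gx G0) subr0.
  by rewrite form_0l.
split; [exact: monotone_form_op|exact: gra_form_op0|].
move=> x f y g Gx Gy; rewrite (form_op_diff _ _ _ _ Gx Gy) => bxy.
have [Dx fx] := Gx; have [Dy gy] := Gy.
have bE z : D z -> b x z = b y z.
  move=> Dz; apply/eqP; rewrite -subr_eq0 -form_subl//; apply/eqP.
  by apply: nd => //; exact: mem_submodB.
by split; split=> // z Dz; rewrite ?fx// ?gy// bE.
Qed.

(** Finiteness of the Fitzpatrick function at [(x, b y)]. The graph points [(a, b a)] suffice, as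
    all values at [a] agree on [D]. *)
Definition rectangular_form := forall x y, D x -> D y ->
  exists M : R, forall a, D a -> b a x + b y a - b a a <= M.

Lemma rectangular_form_op :
  rectangular (form_op D b) <-> rectangular_form.
Proof.
split=> [[_ _ rect] x y Dx Dy|rect].
  have : dom_fitzpatrick (form_op D b) (x, b y).
    by apply: rect; split=> /=; [rewrite dom_form_op|exists y].
  rewrite /dom_fitzpatrick /= => fin.
  have ub a : D a -> ((b a x + b y a - b a a)%:E <=
      fitzpatrick (form_op D b) (x, b y))%E.
    by move=> Da; apply: ereal_sup_ubound; exists (a, b a).
  exists (fine (fitzpatrick (form_op D b) (x, b y))) => a Da.
  rewrite -lee_fin fineK ?ub// fin_numElt fin andbT.
  (* The term at a = 0 excludes the value -oo. *)
  by rewrite (lt_le_trans _ (ub _ (mem_submod0 _ D_submod)))// ltNyr.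
split; [exact: monotone_form_op|exact: gra_form_op0|].
move=> [x f] [/=]; rewrite dom_form_op => Dx [y _ [Dy fy]].
have [M bM] := rect x y Dx Dy.
apply: (@le_lt_trans _ _ M%:E); last exact: ltry.
apply: ge_ereal_sup => _ [[a g] [/= Da ga] <-].
by rewrite lee_fin ga// ga// fy// bM.
Qed.

(** Along the line a = t x the quadratic term vanishes, so t b(x, y) is bounded above in t, which
    forces b(x, y) = 0. *)
Lemma rectangular_nondegenerate : rectangular_form -> nondegenerate_form b.
Proof.
move=> rect x Dx bxx y Dy.
have [M bM] := rect y 0 Dy (mem_submod0 _ D_submod).
have le t : t * b x y <= M.
  have := bM (t *: x) (mem_submodZ _ D_submod t _ Dx).
  rewrite !form_scalel//; last exact: mem_submodZ.
  rewrite form_0l; last exact: mem_submodZ.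
  by rewrite [b x (t *: x)]linearZ/= bxx scaler0 mulr0 addr0 subr0.
apply/eqP/negP => /negP bxy.
have := le ((M + 1) / b x y); rewrite divfK//.
by rewrite gerDl ler10.
Qed.

End additive.

End form_op.

Lemma reflexive_separation {R : realType} {X : normedModType R}
    (M : set (dual X)) (f : dual X) :
  reflexive_space X -> submod_closed (mem M) -> ~ closure M f ->
  exists2 x, (forall g, M g -> g x = 0) & f x != 0.
Proof.
move=> refl sM Mf; have [F FM Ff] := hahn_banach_separation _ _ sM Mf.
have [x _ xF] : range (@canonical_embedding R X) F by rewrite refl.
by move: FM Ff; rewrite -xF => FM Ff; exists x.
Qed.

(** * Symmetric forms and separation from the range *)

Section form_op_range.
Context {R : realType} {X : normedModType R} (D : set X).
Hypotheses (refl : reflexive_space X) (D_submod : submod_closed (mem D)).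
Hypothesis D_closed : closed D.
Context (b c : X -> dual X) (bc : adjoint_forms D b c).
Hypothesis b_ge0 : forall x, D x -> 0 <= b x x.

(** Here b(t x + y, t x + y) = 2 t b(x, y) + b(y, y) is nonnegative for all t, so its slope is
    zero. *)
Lemma sym_nondegenerate : adjoint_forms D b b -> nondegenerate_form D b.
Proof.
move=> bb x Dx bxx y Dy.
suff : b x y *+ 2 = 0 by move/eqP; rewrite mulrn_eq0 => /eqP.
apply: (@affine_ge0_slope _ _ (b y y)) => t.
have Dz := mem_submodP _ D_submod t _ _ Dx Dy.
have := b_ge0 _ Dz; rewrite (form_linl _ D_submod _ _ bb)//.
rewrite !linearP/= bxx (bb y x)//.
by rewrite scaler0 add0r mulr2n mulrDr addrA.
Qed.

(** The separating point lies in [D]: functionals vanishing on [D] are values at 0, hence in the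
    range, so they vanish at [x], and [D] is closed. *)
Lemma separation_ran_form_op f : ~ closure (ran (form_op D b)) f ->
  exists x, [/\ D x, forall y, D y -> b y x = 0 & f x != 0].
Proof.
move=> /(reflexive_separation _ _ refl)[|x ranx fx].
  exact: (submod_ran_form_op _ D_submod _ _ bc).
exists x; split=> // [|y Dy]; last by apply: ranx; exists y.
apply: contrapT => Dx.
have [|d dD /eqP] := hahn_banach_separation D x D_submod.
  by rewrite -(closure_id D).1.
apply; apply: ranx; exists 0 => //; split=> [|y Dy]; first exact: mem_submod0.
by rewrite dD// (form_0l _ D_submod _ _ bc).
Qed.

End form_op_range.

(** * The symmetric part of a form and the equivalences *)

Section symmetric_form.
Context {R : realType} {X : normedModType R} (D : set X).
Hypotheses (refl : reflexive_space X) (D_submod : submod_closed (mem D)).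
Hypothesis D_closed : closed D.

Definition sym_form (b c : X -> dual X) : X -> dual X :=
  fun x => 2^-1 *: (b x + c x).

Lemma sym_formE b c x y : sym_form b c x y = 2^-1 * (b x y + c x y).
Proof. by rewrite /sym_form dualZE dualDE. Qed.

Lemma symmetric_form_op b c :
  op_add (op_scale 2^-1 (form_op D b)) (op_scale 2^-1 (form_op D c)) =
  form_op D (sym_form b c).
Proof.
apply: funext => x; apply/seteqP; split=> [h|h [Dx hx]].
  move=> [_ [f [Dx fx] <-]] [_ [g [_ gx] <-]] <-; split=> // y Dy.
  by rewrite sym_formE dualDE !dualZE fx// gx// mulrDr.
exists (2^-1 *: b x); first by exists (b x) => //; exact: form_opE.
(* On [D] this functional agrees with half of [c x]. Off [D] it absorbs the difference between [h]
   and [sym_form b c x]. *)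
exists (2^-1 *: (2 *: h - b x)).
  exists (2 *: h - b x) => //; split=> // y Dy.
  rewrite dualDE dualZE hx//. rewrite sym_formE -[(- b x) y]/(- b x y).
  by field.
by rewrite -scalerDr addrC subrK scalerA mulVf ?scale1r// pnatr_eq0.
Qed.

Context (b c : X -> dual X) (bc : adjoint_forms D b c).
Hypothesis b_ge0 : forall x, D x -> 0 <= b x x.

Lemma sym_form_adjoint : adjoint_forms D (sym_form b c) (sym_form b c).
Proof. by move=> x y Dx Dy; rewrite !sym_formE !bc// -(bc y x)// addrC. Qed.

Lemma sym_form_diag x : D x -> sym_form b c x x = b x x.
Proof. by move=> Dx; rewrite sym_formE bc//; field. Qed.

Lemma sym_form_ge0 x : D x -> 0 <= sym_form b c x x.
Proof. by move=> Dx; rewrite sym_form_diag// b_ge0. Qed.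

(** The symmetric form s has s(x, x) = b(x, x) = 0, so s(x, y) = 0, which is half of b(x, y) + b(y,
    x). *)
Lemma sym_form_kernel x y : D x -> D y -> b x x = 0 -> b y x = - b x y.
Proof.
move=> Dx Dy bxx.
have := sym_nondegenerate _ D_submod _ sym_form_ge0 sym_form_adjoint x Dx.
rewrite sym_form_diag// => /(_ bxx y Dy); rewrite sym_formE bc// => /eqP.
by rewrite mulf_eq0 invr_eq0 pnatr_eq0/= addrC addr_eq0 => /eqP.
Qed.

Lemma nondegenerate_adjoint :
  nondegenerate_form D b <-> nondegenerate_form D c.
Proof.
split=> nd x Dx; [rewrite bc//|rewrite -bc//] => xx0 y Dy.
  by rewrite bc// sym_form_kernel// nd// oppr0.
have bxx : b x x = 0 by rewrite -bc.
by rewrite -[b x y]opprK -sym_form_kernel// -bc// nd// oppr0.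
Qed.

(** Every [x] with b(x, x) = 0 lies in the kernel of the symmetric form, and on either kernel the
    diagonal vanishes. *)
Lemma ker_sym_form_op : ker (form_op D (sym_form b c)) = ker (form_op D b) <->
  nondegenerate_form D b.
Proof.
rewrite !ker_form_op; split=> [kerE x Dx bxx|nd].
  suff : [set x | D x /\ forall y, D y -> sym_form b c x y = 0] x.
    by rewrite kerE => -[].
  split=> // y Dy; rewrite sym_formE bc// (sym_form_kernel x y)// subrr.
  by rewrite mulr0.
apply/seteqP; split=> x [Dx sx]; split=> // y Dy.
  by apply: nd => //; rewrite -sym_form_diag// sx.
have bxx : b x x = 0 by rewrite sx.
by rewrite sym_formE bc// (sym_form_kernel x y)// subrr mulr0.
Qed.

Lemma rectangular_form_adjoint :
  rectangular_form D b <-> rectangular_form D c.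
Proof.
split=> rect x y Dx Dy; have [M bM] := rect y x Dy Dx; exists M => a Da.
  by rewrite !bc// (addrC (b x a)) bM.
by have := bM a Da; rewrite !bc// (addrC (b y a)).
Qed.

(** Otherwise separation gives [x] in the kernel of the symmetric form with b(w, x) nonzero,
    although b(w, x) = -b(x, w) = 0. *)
Lemma ran_sym_form_sub : nondegenerate_form D b ->
  closed (ran (form_op D (sym_form b c))) ->
  ran (form_op D b) `<=` ran (form_op D (sym_form b c)).
Proof.
move=> nd ranS f [w _ [Dw fw]]; apply: contrapT.
rewrite [X in ~ X f](closure_id _).1//.
move=> /(separation_ran_form_op _ refl D_submod D_closed _ _ sym_form_adjoint).
move=> [x [Dx sx /eqP]]; apply.
have bxx : b x x = 0 by rewrite -sym_form_diag// sx.
by rewrite fw// sym_form_kernel// nd// oppr0.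
Qed.

(** If b(y, .) = s(v, .) and b(x, x) = 0, then b(x, y) = -b(y, x) = -s(v, x) = 0. For the reverse
    inclusion of ranges, a separating [x] has b(., x) = 0, so b(x, w) = -b(w, x) = 0 and s(w, x) =
    0. *)
Lemma closure_ran_form_op :
  closed (ran (form_op D (sym_form b c))) ->
  closure (ran (form_op D b)) = ran (form_op D (sym_form b c)) <->
  nondegenerate_form D b.
Proof.
move=> ranS; split=> [ranE x Dx bxx y Dy|nd].
  have /ran_form_op[v Dv bys] : ran (form_op D (sym_form b c)) (b y).
    by rewrite -ranE; apply: subset_closure; exists y.
  apply/oppr_inj; rewrite -sym_form_kernel// oppr0 bys// sym_form_adjoint//.
  by apply: (sym_nondegenerate _ D_submod _ sym_form_ge0 sym_form_adjoint);
    rewrite ?sym_form_diag.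
apply/seteqP; split.
  rewrite [X in _ `<=` X](closure_id _).1//.
  exact/closure_subset/ran_sym_form_sub.
move=> f [w _ [Dw fw]]; apply: contrapT.
move=> /(separation_ran_form_op _ refl D_submod D_closed _ _ bc).
move=> [x [Dx bx /eqP]]; apply.
rewrite fw// sym_formE bc// bx// -[b x w]opprK -sym_form_kernel ?bx//.
by rewrite oppr0 addr0 mulr0.
Qed.

Lemma nondegenerate_rectangular : nondegenerate_form D b ->
  closed (ran (form_op D (sym_form b c))) -> rectangular_form D b.
Proof.
move=> nd ranS x y Dx Dy; set s := sym_form b c.
have Dyx := mem_submodB _ D_submod _ _ Dy Dx.
have /ran_form_op[v Dv bv] : ran (form_op D s) (b (y - x)).
  by apply: ran_sym_form_sub => //; exists (y - x).
have ss : adjoint_forms D s s := sym_form_adjoint.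
have sE z t : s z t = 2^-1 * (b z t + c z t) := sym_formE _ _ _ _.
have s_ge0 : forall z, D z -> 0 <= s z z := sym_form_ge0.
have s_diag : forall z, D z -> s z z = b z z := sym_form_diag.
clearbody s.
(* As b(a, x) = 2 s(x, a) - b(x, a) and b(y - x, .) = s(v, .), the expression to bound is 2 s(u, a)
   - s(a, a). It is at most s(u, u) because s(a - u, a - u) >= 0. *)
pose u := 2^-1 *: v + x.
have Du : D u by apply: mem_submodP.
exists (s u u) => a Da.
have := s_ge0 _ (mem_submodB _ D_submod _ _ Da Du).
rewrite (form_subl _ D_submod _ _ ss)//; last exact: mem_submodB.
rewrite (linearB (s a)) (linearB (s u)) /= (ss a u)// s_diag//.
rewrite (_ : s u a = 2^-1 * s v a + s x a); last first.
  by rewrite (form_linl _ D_submod _ _ ss).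
rewrite -bv// (form_subl _ D_submod _ _ bc)// sE (bc x a)//.
by lra.
Qed.

Lemma form_op_tfae : closed (ran (form_op D (sym_form b c))) ->
  [<-> rectangular (form_op D b);
       closure (ran (form_op D b)) = ran (form_op D (sym_form b c));
       ker (form_op D (sym_form b c)) = ker (form_op D b);
       paramonotone (form_op D b);
       paramonotone (form_op D c);
       rectangular (form_op D c)].
Proof.
move=> ranS; have cb := adjoint_forms_sym _ _ _ bc.
have c_ge0 x : D x -> 0 <= c x x by move=> Dx; rewrite bc// b_ge0.
have rectE := rectangular_form_op _ D_submod _ _ bc b_ge0.
have rectcE := rectangular_form_op _ D_submod _ _ cb c_ge0.
have paraE := paramonotone_form_op _ D_submod _ _ bc b_ge0.
have paracE := paramonotone_form_op _ D_submod _ _ cb c_ge0.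
tfae.
- move=> /rectE /(rectangular_nondegenerate _ D_submod _ _ bc).
  by move/(closure_ran_form_op ranS).
- by move/(closure_ran_form_op ranS)/ker_sym_form_op.
- by move/ker_sym_form_op/paraE.
- by move=> /paraE/nondegenerate_adjoint/paracE.
- move=> /paracE/nondegenerate_adjoint nd.
  exact/rectcE/rectangular_form_adjoint/nondegenerate_rectangular.
- by move=> /rectcE/rectangular_form_adjoint/rectE.
Qed.

End symmetric_form.

(** * Monotone linear relations *)

Section monotone_linear_relation.
Context {R : realType} {X : normedModType R} (A : X -> set (dual X)).
Hypotheses (A_linear : linear_relation A) (A_mono : monotone A).

Lemma linear_relation0 : A 0 0.
Proof. by have /linear_relationP[] := A_linear. Qed.

Lemma linear_relationD k x y f g :
  A x f -> A y g -> A (k *: x + y) (k *: f + g).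
Proof. by have /linear_relationP[_] := A_linear; apply. Qed.

Lemma linear_relationZ k x f : A x f -> A (k *: x) (k *: f).
Proof.
move=> Ax; have := linear_relationD k _ _ _ _ Ax linear_relation0.
by rewrite !addr0.
Qed.

Lemma linear_relationB x y f g : A x f -> A y g -> A (x - y) (f - g).
Proof.
move=> Ax Ay; have := linear_relationD (-1) _ _ _ _ Ay Ax.
by rewrite !scaleN1r addrC [- g + f]addrC.
Qed.

Lemma submod_dom : submod_closed (mem (dom A)).
Proof.
split; first by apply/mem_set; exists 0; exact: linear_relation0.
move=> k x y /set_mem[f Ax] /set_mem[g Ay]; apply/mem_set.
by exists (k *: f + g); exact: linear_relationD.
Qed.

Lemma monotone_ge0 x f : A x f -> 0 <= f x.
Proof.
by move=> Ax; have := A_mono _ _ _ _ Ax linear_relation0; rewrite !subr0.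
Qed.

(** For [g] in [A y], every t d + g is again a value at [y], so t d(y) + g(y) >= 0 for all t. *)
Lemma monotone_image0 d y : A 0 d -> dom A y -> d y = 0.
Proof.
move=> A0d [g Ay]; apply: (@affine_ge0_slope _ _ (g y)) => t.
have := monotone_ge0 _ _ (linear_relationD t _ _ _ _ A0d Ay).
by rewrite scaler0 add0r dualDE dualZE.
Qed.

Lemma monotone_image_eq x f g y : A x f -> A x g -> dom A y -> f y = g y.
Proof.
move=> Af Ag Ay; apply/eqP; rewrite -subr_eq0; apply/eqP.
apply: (monotone_image0 (f - g)) => //.
by rewrite -(subrr x); exact: linear_relationB.
Qed.

(** For any selection [b] the form operator extends [A], and it is still monotone since pairings of
    its elements reduce to those of [b]. Maximality gives equality. *)
Lemma maximally_monotone_form_op (b : X -> dual X) :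
  maximally_monotone A -> (forall x, dom A x -> A x (b x)) ->
  A = form_op (dom A) b.
Proof.
move=> [_ Amax] Ab.
have sub x f : A x f -> form_op (dom A) b x f.
  move=> Ax; split; first by exists f.
  by move=> y Ay; apply: (monotone_image_eq x) => //; apply: Ab; exists f.
apply: contrapT => neq; apply: Amax; exists (form_op (dom A) b); split.
  move=> x f y g [/= Dx fb] [/= Dy gb].
  have Dxy : dom A (x - y).
    by exists (b x - b y); apply: linear_relationB; exact: Ab.
  rewrite -[leRHS]/(f (x - y) - g (x - y)) fb// gb//.
  by apply: A_mono; exact: Ab.
split; first by move=> [x f]; exact: sub.
move=> sup; apply: neq; apply: funext => x; apply/seteqP; split=> f.
  exact: sub.
exact: (sup (x, f)).
Qed.

End monotone_linear_relation.

(** * Boundedness and the adjoint on a closed domain *)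

Section closed_domain.
Context {R : realType} {X : completeNormedModType R} (A : X -> set (dual X)).
Hypotheses (A_linear : linear_relation A) (A_mono : monotone A).
Hypothesis dom_closed : closed (dom A).

(* For |a| <= 1, monotonicity bounds |f y| by f a plus a constant depending on
   y, so the functionals f / (1 + f a) are pointwise, hence uniformly, bounded
   by some K.  Taking y = 2 K a for a small enough gives f a <= 1. *)
Lemma monotone_bounded : exists2 K : R, 0 <= K &
  forall a f y, A a f -> dom A y -> `|f y| <= K * `|a| * `|y|.
Proof.
have A_ge0 := monotone_ge0 _ A_linear A_mono.
have AZ := linear_relationZ _ A_linear.
pose F := [set h : dual X | exists a f,
  [/\ A a f, `|a| <= 1 & h = (1 + f a)^-1 *: f]].
have one_gt0 a f : A a f -> 0 < 1 + f a.
  by move=> Aa; rewrite ltr_pwDl// A_ge0.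
have [y [g Ay]|K K1 FK] :=
    dual_bounded_on_closed (dom A) F (submod_dom _ A_linear) dom_closed.
(* Monotonicity against [(y, g)] and its negative gives |f y| <= f a + g y + |g|, which is at most
   this constant times 1 + f a. *)
- exists (1 + g y + `|g|) => _ [a [f [Aa a1 ->]]].
  have one := one_gt0 _ _ Aa.
  have inv_ge0 : 0 <= (1 + f a)^-1 by rewrite invr_ge0 ltW.
  rewrite dualZE normrM (ger0_norm inv_ge0) mulrC ler_pdivrMr//.
  have ga : `|g a| <= `|g| by exact: dual_norm_le1.
  have : 0 <= f a - g a - (f y - g y).
    by have := A_mono _ _ _ _ Aa Ay; rewrite linearB.
  have : 0 <= f a + g a + (f y + g y).
    have := A_mono _ _ _ _ Aa (AZ (-1) _ _ Ay).
    by rewrite !scaleN1r !opprK linearD.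
  have := A_ge0 _ _ Aa; have := A_ge0 _ _ Ay.
  move: ga; rewrite !ler_norml => /andP[]; have := normr_ge0 g.
  move: (f a) (f y) (g a) (g y) (`|g|) => *.
  by apply/andP; split; nra.
have K0 : 0 < K by rewrite (lt_le_trans _ K1).
have fK a f y : A a f -> `|a| <= 1 -> dom A y -> `|y| <= 1 ->
    `|f y| <= K * (1 + f a).
  move=> Aa a1 Dy y1.
  have Fh : F ((1 + f a)^-1 *: f) by exists a, f.
  have := FK _ _ Fh Dy y1.
  have one := one_gt0 _ _ Aa; have inv_ge0 : 0 <= (1 + f a)^-1.
    by rewrite invr_ge0 ltW.
  by rewrite dualZE normrM (ger0_norm inv_ge0) mulrC ler_pdivrMr.
have fK2 a f y : A a f -> `|a| <= (2 * K)^-1 -> dom A y -> `|y| <= 1 ->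
    `|f y| <= 2 * K.
  move=> Aa aK Dy y1.
  have a1 : `|a| <= 1 by rewrite (le_trans aK)// invf_le1; lra.
  have fa1 : f a <= 1.
    have Da : dom A (2 * K *: a) by exists (2 * K *: f); exact: AZ.
    have := fK _ _ _ Aa a1 Da; rewrite normrZ ger0_norm; last by lra.
    rewrite mulrC -ler_pdivlMr ?mulr_gt0// mul1r => /(_ aK).
    rewrite linearZ/= => /(le_trans (ler_norm _)).
    rewrite -[_ *: _]/(2 * K * f a) => h.
    by rewrite -(ler_pM2l K0); lra.
  by apply: le_trans (fK _ _ _ Aa a1 Dy y1) _; nra.
(* One factor 2 K is the bound in [fK2]; the other comes from scaling [a] to norm 1 / (2 K). *)
exists (2 * K * (2 * K)); first by rewrite !mulr_ge0// ltW.
move=> a f y Aa Dy.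
have [y0|y0] := eqVneq y 0; first by rewrite y0 linear0 !normr0 mulr0.
have [a0|a0] := eqVneq a 0.
  rewrite (monotone_image0 _ A_linear A_mono f y) -?a0// normr0.
  by rewrite !mulr_ge0// ltW.
have na : 0 < `|a| by rewrite normr_gt0.
have ny : 0 < `|y| by rewrite normr_gt0.
have Dy' : dom A (`|y|^-1 *: y).
  by case: Dy => g Ay; exists (`|y|^-1 *: g); exact: AZ.
have z0 : 0 < 2 * K * `|a| by rewrite !mulr_gt0.
have nz : `|(2 * K * `|a|)^-1 *: a| <= (2 * K)^-1.
  by rewrite normrZ normfV (gtr0_norm z0) invfM mulfVK ?gt_eqF.
have ny1 : `| `|y|^-1 *: y | <= 1.
  by rewrite normrZ normfV normr_id mulVf ?gt_eqF.
have := fK2 _ _ _ (AZ _ _ _ Aa) nz Dy' ny1.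
rewrite dualZE linearZ/= -[_ *: f y]/(`|y|^-1 * f y) !normrM !normfV normr_id.
rewrite (gtr0_norm z0) ler_pdivrMl// ler_pdivrMl// => /le_trans; apply.
by rewrite le_eqVlt; apply/orP; left; apply/eqP; ring.
Qed.

(** The relation sending [a] to all [g x] with [g] in [A a] is linear and bounded by K |x| |a|, so
    it extends to a functional, a value of the adjoint at [x]. *)
Lemma adjoint_value x : dom A x -> exists f : dual X,
  forall a g, A a g -> f a = g x.
Proof.
move=> Dx; have [K K0 AK] := monotone_bounded.
pose G v : set R^o := [set g x | g in A v].
have [||f fG] := @hahn_banach_dominated _ _ (K * `|x|) G.
- by rewrite mulr_ge0.
- split.
    apply/linear_relationP; split.
      by exists 0 => //; exact: linear_relation0.
    move=> k u v _ _ [g Au <-] [h Av <-]; exists (k *: g + h) => //.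
    exact: linear_relationD.
  move=> v _ [g Av <-]; rewrite mulrAC.
  exact: le_trans (ler_norm _) (AK _ _ _ Av Dx).
by exists f => a g Aa; apply: fG; exists g.
Qed.

Lemma adjoint_form_op (b c : X -> dual X) : A = form_op (dom A) b ->
  adjoint_forms (dom A) b c -> adjoint A = form_op (dom A) c.
Proof.
move=> Ab bc; have sD := submod_dom _ A_linear.
have bA y : dom A y -> A y (b y) by move=> Dy; rewrite Ab; exact: form_opE.
apply: funext => x; apply/seteqP; split=> f fx.
  (* A functional [d] vanishing on [dom A] belongs to [A 0], so the adjoint condition gives d(x) =
     0. Hence [x] cannot be separated from the closed domain. *)
  have Dx : dom A x.
    apply: contrapT => Dx.
    have [|d dD /eqP] := hahn_banach_separation (dom A) x sD.
      by rewrite -(closure_id _).1.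
    apply; rewrite -[LHS]/(canonical_embedding x d) -(fx 0) ?linear0//.
    rewrite /gra/= Ab; split=> [|y Dy]; first exact: mem_submod0.
    by rewrite dD// (form_0l _ sD _ _ bc).
  by split=> // y Dy; rewrite bc//; apply: fx; exact: bA.
move=> a g Aa; have Da : dom A a by exists g.
move: Aa; rewrite /gra/= Ab => -[_ ga].
by case: fx => Dx fx; rewrite fx// bc// -ga.
Qed.

End closed_domain.

Theorem theorem4p7 (R : realType) (X : completeNormedModType R)
    (X_reflexive : reflexive_space X) (A : X -> set (dual X))
    (A_maximal : maximally_monotone A) (A_linear : linear_relation A)
    (dom_closed : closed (dom A))
    (ran_closed : closed (ran (symmetric_part A))) :
  [<-> rectangular A;
       closure (ran A) = ran (symmetric_part A);
       ker (symmetric_part A) = ker A;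
       paramonotone A;
       paramonotone (adjoint A);
       rectangular (adjoint A)].
Proof.
have A_mono := A_maximal.1.
have sD := submod_dom _ A_linear.
(* Outside [dom A] the forms take the irrelevant default 0. *)
have /choice[b Ab] x : exists f, dom A x -> A x f.
  by have [[f Ax]|nD] := pselect (dom A x); [exists f|exists 0].
have /choice[c cA] x : exists f : dual X,
    dom A x -> forall a g, A a g -> f a = g x.
  have [/(adjoint_value _ A_linear A_mono dom_closed)[f fx]|nD] :=
    pselect (dom A x); [by exists f|by exists 0].
have bc : adjoint_forms (dom A) b c.
  by move=> x y Dx Dy; apply: cA => //; exact: Ab.
have b_ge0 x : dom A x -> 0 <= b x x.
  by move=> Dx; apply: (monotone_ge0 _ A_linear A_mono); exact: Ab.
have AE := maximally_monotone_form_op _ A_linear A_mono _ A_maximal Ab.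
have A'E := adjoint_form_op _ A_linear dom_closed _ _ AE bc.
have SE : symmetric_part A = form_op (dom A) (sym_form b c).
  by rewrite /symmetric_part A'E {1}AE symmetric_form_op.
have ranS : closed (ran (form_op (dom A) (sym_form b c))) by rewrite -SE.
have := form_op_tfae _ X_reflexive sD dom_closed _ _ bc b_ge0 ranS.
by rewrite -SE -A'E -AE.
Qed.
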